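(* Let $U\subseteq R^m(-\mathbf d)$ be a quasi-stable module. Then the projections onto the first factor $\pi_1:\underline{\mathbf{Mf}}^{\mathrm{syz}}_U\to\underline{\mathbf{Mf}}_U$ and $\pi_1:\underline{\mathbf{Mf}}^{\mathrm{res}}_U\to\underline{\mathbf{Mf}}_U$, defined for every Noetherian $\mathbb K$-algebra $A$ by $(M,S_1)\mapsto M$ and $(M,S_1,\dots,S_{n-D})\mapsto M$ respectively, are natural isomorphisms of functors.
   Context: $\mathbb K$ is a field, $R=\mathbb K[x_0,\dots,x_n]$ with the standard grading and $x_0<\dots<x_n$; for a Noetherian $\mathbb K$-algebra $A$, $R_A=R\otimes_{\mathbb K}A$. A term of $R$ is a monomial $x^\alpha$; for $x^\alpha\neq1$, $\min(x^\alpha)$ is the smallest variable dividing it. Variables $x_i>\min(x^\alpha)$ are non-multiplicative for $x^\alpha$ (the term $1$ has no non-multiplicative variables). $R_A^m(-\mathbf d)=\bigoplus_k R_A(-d_k)\mathbf e_k$, with terms $x^\alpha\mathbf e_k$ of degree $|\alpha|+d_k$. All submodules are graded. A submodule is monomial if generated by terms; $\mathcal N(U)$ is the set of terms not in $U$. Pommaret cone: $\mathcal C(x^\alpha)=\{x^\delta x^\alpha\mid\delta_i=0\ \forall x_i>\min(x^\alpha)\}$ for $x^\alpha\neq 1$, $\mathcal C(1)=$ all terms, $\mathcal C(x^\alpha\mathbf e_k)=\mathcal C(x^\alpha)\mathbf e_k$. A Pommaret basis of $U$ is a set of terms generating $U$ whose cones partition the set of terms of $U$; it is unique if it exists, denoted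 $\mathcal P_U$. $U$ is quasi-stable if it has a finite Pommaret basis, stable if moreover $\mathcal P_U$ is its minimal monomial generating set. Put $D=\min\{i\mid x_i=\min(x^\alpha),\ x^\alpha\mathbf e_k\in\mathcal P_U\}$. A $U$-marked set in $R_A^m(-\mathbf d)$ is a finite set $F=\{f_{\alpha,k}\}_{x^\alpha\mathbf e_k\in\mathcal P_U}$ of homogeneous elements such that $x^\alpha\mathbf e_k$ has coefficient $1$ in $f_{\alpha,k}$ and the support of $f_{\alpha,k}-x^\alpha\mathbf e_k$ is in $\mathcal N(U)$; it is a $U$-marked basis of $(F)$ if $R_A^m(-\mathbf d)=(F)\oplus\langle\mathcal N(U)\rangle_A$ (equivalently in each degree). A graded submodule $M$ satisfies $M\oplus\langle\mathcal N(U)\rangle=R_A^m(-\mathbf d)$ iff it is generated by a (necessarily unique) $U$-marked basis $F$. Then each $f\in(F)$ has a unique writing $f=\sum P_{\gamma,\ell}f_{\gamma,\ell}$ with all terms of $P_{\gamma,\ell}x^\gamma$ in $\mathcal C(x^\gamma)$. Fundamental syzygies: for $x_i>\min(x^\alpha)$, $S_{i,\alpha,k}=x_i\mathbf f_{\alpha,k}-\sum P_{\gamma,\ell}\mathbf f_{\gamma,\ell}$, where $x_if_{\alpha,k}=\sum P_{\gamma,\ell}f_{\gamma,\ell}$ is the unique writing and $\mathbf f_{\alpha,k}$ is the standard basis of $\bigoplus R_A(-\deg x^\alpha\mathbf e_k)\mathbf f_{\alpha,k}$. They form a set $F^{\partial_1}$ which is a marked basis (head terms $x_i\mathbf f_{\alpha,k}$)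 of the syzygy module of $F$ over the stable module $U^{(1)}$ with Pommaret basis $\{x_i\mathbf f_{\alpha,k}\mid x_i>\min(x^\alpha)\}$. Iterating, $F^{\partial_0}=F$ and $F^{\partial_t}$ is the set of fundamental syzygies of $F^{\partial_{t-1}}$. Functors from Noetherian $\mathbb K$-algebras to sets: $\underline{\mathbf{Mf}}_U(A)=\{M\subset R_A^m(-\mathbf d)\mid M\oplus\langle\mathcal N(U)\rangle=R_A^m(-\mathbf d)\}$; $\underline{\mathbf{Mf}}^{\mathrm{syz}}_U(A)=\{(M,S_1)\mid M\in\underline{\mathbf{Mf}}_U(A),\ S_1\text{ is the syzygy module of }F^{\partial_0}\}$; $\underline{\mathbf{Mf}}^{\mathrm{res}}_U(A)=\{(M,S_1,\dots,S_{n-D})\mid M\in\underline{\mathbf{Mf}}_U(A),\ S_t\text{ is the syzygy module of }F^{\partial_{t-1}}\ \forall t>0\}$, where $F$ is the $U$-marked basis of $M$. On morphisms $\sigma:A\to A'$ they act by extension of scalars (applying $\sigma$ to the coefficients of the marked bases). *)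

(* Defs.v *)
From HB Require Import structures.
From mathcomp Require Import all_boot all_order all_algebra.
From mathcomp Require Import finmap.
From mathcomp Require Import boolp classical_sets functions.
From mathcomp Require Import freeg mpoly.

Set Implicit Arguments.
Unset Strict Implicit.
Unset Printing Implicit Defensive.

Import GRing.Theory.

Local Open Scope ring_scope.
Local Open Scope classical_set_scope.

Section Modules.
Context {R : nzRingType} {V : lmodType R}.

Definition submodule (M : set V) : Prop :=
  [/\ M 0, forall u v, M u -> M v -> M (u + v) & forall a u, M u -> M (a *: u)].

Definition span (S : set V) : set V := smallest submodule S.

(* V = M (+) N as abelian groups; N need not be an R-submodule. *)
Definition direct_decomposition (M N : set V) : Prop :=
  M `&` N = [set 0] /\ forall f, exists u v, [/\ M u, N v & f = u + v].

End Modules.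

Definition noetherian (A : nzRingType) : Prop :=
  forall I : set A^o, submodule I -> exists s : seq A^o, I = span [set` s].

(* R_A^I for R_A = A[x_0, .., x_n]; the regular-module tag ^o makes R_A act
   by scaling. *)
Notation freemod A n I := {ffun I -> {mpoly A[n.+1]}^o}.

Section Terms.
Context {n : nat}.
Implicit Types (a b : 'X_{1..n.+1}) (i : 'I_n.+1).

Definition min_var a : option 'I_n.+1 :=
  [pick i | (a i != 0)%N && [forall j, (a j != 0)%N ==> (i <= j)%N]].

Definition nonmult a i : bool := if min_var a is Some j then (j < i)%N else false.

Definition cone a : set 'X_{1..n.+1} :=
  [set (e + a)%MM | e in [set e : 'X_{1..n.+1} | forall i, nonmult a i -> e i = 0%N]].

Definition mcone {I : Type} (t : 'X_{1..n.+1} * I) : set ('X_{1..n.+1} * I) :=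
  [set (b, t.2) | b in cone t.1].

End Terms.

Section FreeModules.
Context {A : comNzRingType} {n : nat} {I : finType}.
Implicit Types (f : freemod A n I) (t : 'X_{1..n.+1} * I).

(* The term x^a e_k, as an element of the free module. *)
Definition termv t : freemod A n I :=
  [ffun k => if k == t.2 then 'X_[t.1] else 0].

Definition coefv f t : A := (f t.2 : {mpoly A[n.+1]})@_(t.1).

(* For a set N of terms this is the A-span of N. *)
Definition supported_in (N : set ('X_{1..n.+1} * I)) : set (freemod A n I) :=
  [set f | forall t, coefv f t != 0 -> N t].

Definition tdeg (d : I -> int) t : int := (mdeg t.1)%:Z + d t.2.

Definition homogeneous (d : I -> int) (s : int) f : Prop :=
  forall t, coefv f t != 0 -> tdeg d t = s.

Definition hcomp (d : I -> int) (s : int) f : freemod A n I :=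
  [ffun k => \sum_(a <- msupp (f k : {mpoly A[n.+1]}) | tdeg d (a, k) == s)
               coefv f (a, k) *: 'X_[a] ].

Definition graded (d : I -> int) (M : set (freemod A n I)) : Prop :=
  forall f s, M f -> M (hcomp d s f).

End FreeModules.

Section BaseChange.
Context {n : nat} {I : finType}.

Definition map_freemod (A B : comNzRingType) (s : A -> B) (f : freemod A n I)
    : freemod B n I := [ffun k => map_mpoly s (f k)].

(* The image of M (x)_A B in R_B^I. *)
Definition base_change (A B : comNzRingType) (s : A -> B)
    (M : set (freemod A n I)) : set (freemod B n I) :=
  span (map_freemod s @` M).

(* Extending scalars amounts to applying s to the coefficients of any set of
   generators, in particular of a marked basis. *)
Lemma base_change_span (A B : comNzRingType) (s : {rmorphism A -> B})
    (S : set (freemod A n I)) :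
  base_change s (span S) = span (map_freemod s @` S).
Proof.
have spanS (C : comNzRingType) (T : set (freemod C n I)) : submodule (span T).
  split=> [N [[N0 _ _] _]|u v hu hv N hN|a u hu N hN] //.
    by have [[_ ND _] _] := hN; apply: ND; [apply: hu|apply: hv].
  by have [[_ _ NZ] _] := hN; apply: NZ; apply: hu.
apply/seteqP; split=> v hv N [subN sN]; apply: hv; split=> // w [f hf <-]; last first.
  by apply: sN; exists f => // L [_ SL]; apply: SL.
have [N0 ND NZ] := subN.
apply: (hf [set f | N (map_freemod s f)]); split; last by move=> g Sg; apply: sN; exists g.
split=> [/=|g h /= Ng Nh|p g /= Ng].
- have -> : map_freemod s (0 : freemod A n I) = 0 by apply/ffunP=> k; rewrite !ffunE raddf0.
  exact: N0.
- have -> : map_freemod s (g + h) = map_freemod s g + map_freemod s h.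
    by apply/ffunP=> k; rewrite !ffunE raddfD.
  exact: ND.
- have -> : map_freemod s (p *: g) = map_mpoly s p *: map_freemod s g.
    by apply/ffunP=> k; rewrite !ffunE; apply: rmorphM.
  exact: NZ.
Qed.

End BaseChange.

Section QuasiStable.
Context {K : fieldType} {n m : nat}.
Implicit Type U : set (freemod K n 'I_m).

Definition terms_in U : set ('X_{1..n.+1} * 'I_m) := [set t | U (termv t)].

(* \mathcal N(U) *)
Definition normal_terms U : set ('X_{1..n.+1} * 'I_m) := ~` terms_in U.

Definition pommaret_basis U (P : {fset 'X_{1..n.+1} * 'I_m}) : Prop :=
  U = span (termv @` [set` P]) /\ partition [set` P] mcone (terms_in U).

(* In particular U is a monomial submodule. *)
Definition quasi_stable U : Prop := exists P, pommaret_basis U P.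

(* \mathcal P_U; the default value is never used for quasi-stable U. *)
Definition pommaret U : {fset 'X_{1..n.+1} * 'I_m} :=
  xget fset0 [set P | pommaret_basis U P].

(* The index D. It is n when no element of the Pommaret basis involves a
   variable: then no term has a non-multiplicative variable, and n - D = 0. *)
Definition min_index U : nat :=
  \big[minn/n]_(t : pommaret U)
     (if min_var (val t).1 is Some i then nat_of_ord i else n).

End QuasiStable.

(* A finite set of terms, indexed by fidx, in a free module with standard basis
   indexed by fbas. *)
Record frame (n : nat) := Frame {
  fbas : finType;
  fidx : finType;
  head : fidx -> 'X_{1..n.+1} * fbas
}.

(* From the Pommaret basis of U^(t) to that of U^(t+1): the terms x_i f_j with
   x_i non-multiplicative for the j-th term. *)
Definition next_frame (n : nat) (L : frame n) : frame n :=
  @Frame n (fidx L)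
    {p : 'I_n.+1 * fidx L | nonmult (head p.2).1 p.1}
    (fun p => (U_((val p).1)%MM, (val p).2)).

Definition pommaret_frame (K : fieldType) (n m : nat)
    (U : set (freemod K n 'I_m)) (t : nat) : frame n :=
  iter t (@next_frame n)
    (@Frame n 'I_m (pommaret U) (fun t => val t)).

Section Syzygies.
Context {A : comNzRingType} {n : nat}.

Definition lincomb {I J : finType} (F : J -> freemod A n I) (P : freemod A n J)
    : freemod A n I :=
  \sum_j (P j : {mpoly A[n.+1]}) *: F j.

Definition syzygies {I J : finType} (F : J -> freemod A n I)
    : set (freemod A n J) := [set P | lincomb F P = 0].

(* All terms of P_g x^g lie in the cone of x^g, for every head term x^g e_l. *)
Definition multiplicative (L : frame n) (P : freemod A n (fidx L)) : Prop :=
  forall g a, coefv P (a, g) != 0 -> cone (head g).1 (a + (head g).1)%MM.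

Definition fundamental_syzygies (L : frame n)
    (F : fidx L -> freemod A n (fbas L))
    (G : fidx (next_frame L) -> freemod A n (fidx L)) : Prop :=
  forall p, exists P : freemod A n (fidx L),
    [/\ multiplicative P,
        'X_((val p).1) *: F (val p).2 = lincomb F P
      & G p = termv (U_((val p).1)%MM, (val p).2) - P].

End Syzygies.

Section MarkedFunctors.
Context {K : fieldType} {n m : nat}.
Variables (d : 'I_m -> int) (U : set (freemod K n 'I_m)).

Local Notation fr := (pommaret_frame U).

Section Points.
Variable A : comNzRingType.
Implicit Type M : set (freemod A n 'I_m).

Definition marked_set (F : fidx (fr 0) -> freemod A n 'I_m) : Prop :=
  forall j, [/\ exists s, homogeneous d s (F j),
                coefv (F j) (head j) = 1
              & supported_in (normal_terms U) (F j - termv (head j))].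

(* F is a U-marked basis, and it generates M. *)
Definition marked_basis (F : fidx (fr 0) -> freemod A n 'I_m) M : Prop :=
  [/\ marked_set F, M = span (range F)
    & direct_decomposition (span (range F)) (supported_in (normal_terms U))].

Definition Mf_set : set (set (freemod A n 'I_m)) :=
  [set M | [/\ submodule M, graded d M
             & direct_decomposition M (supported_in (normal_terms U))]].

Definition Mfsyz_carrier : Type :=
  (set (freemod A n 'I_m) * set (freemod A n (fidx (fr 0))))%type.

Definition Mfsyz_set : set Mfsyz_carrier :=
  [set MS | Mf_set MS.1 /\
     exists F, marked_basis F MS.1 /\ MS.2 = syzygies F].

(* (M, S_1, .., S_{n-D}): the component of index t < n - D is S_{t+1}. *)
Definition Mfres_carrier : Type :=
  (set (freemod A n 'I_m) *
   (forall t : 'I_(n - min_index U), set (freemod A n (fidx (fr t)))))%type.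

(* F t is the iterated set of fundamental syzygies F^{\partial_t}. *)
Definition Mfres_set : set Mfres_carrier :=
  [set MS | Mf_set MS.1 /\
     exists F : forall t : nat, fidx (fr t) -> freemod A n (fbas (fr t)),
       [/\ marked_basis (F 0) MS.1,
           forall t, @fundamental_syzygies A n (fr t) (F t) (F t.+1)
         & forall t : 'I_(n - min_index U), MS.2 t = syzygies (F t)]].

End Points.
End MarkedFunctors.

(* Set-valued functors on Noetherian K-algebras, presented as subsets pts A of
   ambient types carrier A. *)
Record functor_data (K : fieldType) := FunctorData {
  carrier : comAlgType K -> Type;
  pts : forall A : comAlgType K, set (carrier A);
  act : forall A B : comAlgType K, {lrmorphism A -> B} -> carrier A -> carrier B
}.
Arguments carrier {K}.
Arguments pts {K}.
Arguments act {K} f {A B}.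

Definition is_functor (K : fieldType) (X : functor_data K) : Prop :=
  [/\ forall (A B : comAlgType K) (s : {lrmorphism A -> B}),
        noetherian A -> noetherian B ->
        forall x, pts X A x -> pts X B (act X s x),
      forall A : comAlgType K, noetherian A ->
        forall x, pts X A x -> act X (idfun : {lrmorphism A -> A}) x = x
    & forall (A B C : comAlgType K)
             (s : {lrmorphism A -> B}) (t : {lrmorphism B -> C}),
        noetherian A -> noetherian B -> noetherian C ->
        forall x, pts X A x ->
          act X (t \o s : {lrmorphism A -> C}) x = act X t (act X s x)].

Definition natural_isomorphism (K : fieldType) (X Y : functor_data K)
    (eta : forall A, carrier X A -> carrier Y A) : Prop :=
  [/\ is_functor X, is_functor Y,
      forall (A B : comAlgType K) (s : {lrmorphism A -> B}),
        noetherian A -> noetherian B ->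
        forall x, pts X A x -> eta B (act X s x) = act Y s (eta A x)
    & forall A : comAlgType K, noetherian A ->
        set_bij (pts X A) (pts Y A) (eta A)].

Section Functors.
Context {K : fieldType} {n m : nat}.
Variables (d : 'I_m -> int) (U : set (freemod K n 'I_m)).

Definition Mf : functor_data K :=
  @FunctorData K (fun A => set (freemod A n 'I_m)) (fun A => @Mf_set K n m d U A)
    (fun A B s M => base_change s M).

Definition Mfsyz : functor_data K :=
  @FunctorData K (fun A => Mfsyz_carrier U A) (fun A => @Mfsyz_set K n m d U A)
    (fun A B s MS => (base_change s MS.1, base_change s MS.2)).

Definition Mfres : functor_data K :=
  @FunctorData K (fun A => Mfres_carrier U A) (fun A => @Mfres_set K n m d U A)
    (fun A B s MS => (base_change s MS.1, fun t => base_change s (MS.2 t))).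

End Functors.

(* Main.v *)
From HB Require Import structures.
From mathcomp Require Import all_boot all_order all_algebra.
From mathcomp Require Import finmap.
From mathcomp Require Import boolp classical_sets.
From mathcomp Require Import mpoly.

Import GRing.Theory.

Require Import Defs.

(** A point M of Mf_U has exactly one U-marked basis F, and the unique
    multiplicative writings over F determine the fundamental syzygies, hence the
    whole chain of syzygy modules above M. So both projections are bijective on
    points, and they commute with extension of scalars by definition. What takes
    work is that the points over M form a functor: extending scalars must turn
    the syzygy module of each F^(t) into the syzygy module of its image.

    All levels of the chain are treated at once. A frame whose heads have
    disjoint cones with a union closed under multiplication
    ([pommaret_heads]) stands for the Pommaret basis of a monomial module, and
    this property passes to the frame of the fundamental syzygies
    ([pommaret_heads_next]). Over such a frame, rewriting by a marked set
    strictly decreases the multiplier in the lexicographic order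
    ([normal_lex_lt]). This gives termination, so that every element is a
    multiplicative combination of the marked set plus a normal element
    ([marked_decomposition]), and it also makes such writings unique
    ([multiplicative_normal_eq0]). The normal terms of the next frame are
    precisely the terms that a multiplicative combination may involve. Hence
    uniqueness at one level says that no nonzero normal element of the next is a
    syzygy, so that the fundamental syzygies are a marked basis of the syzygy
    module ([fundamental_syzygies_basis]).

    Being a marked basis survives extension of scalars because the projection
    onto the normal terms is linear over the coefficient ring
    ([frame_basis_map]). As the image of a fundamental syzygy is a fundamental
    syzygy, the syzygy module over the new ring is generated by the images of the
    old generators ([base_change_syzygies]). *)

Set Implicit Arguments.
Unset Strict Implicit.
Unset Printing Implicit Defensive.

Local Open Scope ring_scope.
Local Open Scope classical_set_scope.

(** * The lexicographic order on exponents *)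

Section Lex.
Context {n : nat}.
Implicit Types (a b c : 'X_{1..n}) (i j : 'I_n).

(** The largest variable whose exponents differ decides. An order by degree first
    would not do: rewriting can raise the degree of the multiplier. *)
Definition lex_lt a b : Prop :=
  exists i, (a i < b i)%N /\ forall j, (i < j)%N -> a j = b j.

Lemma lex_ltxx a : ~ lex_lt a a.
Proof. by case=> i []; rewrite ltnn. Qed.

Lemma lex_lt_trans a b c : lex_lt a b -> lex_lt b c -> lex_lt a c.
Proof.
move=> [i [ltab eqab]] [j [ltbc eqbc]].
have [ij|ji|/val_inj eij] := ltngtP i j.
- exists j; split=> [|k jk]; first by rewrite eqab.
  by rewrite eqab ?eqbc // (ltn_trans ij).
- exists i; split=> [|k ik]; first by rewrite -eqbc.
  by rewrite eqab ?eqbc // (ltn_trans ji).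
- subst j; exists i; split=> [|k ik]; first exact: ltn_trans ltbc.
  by rewrite eqab ?eqbc.
Qed.

Lemma lex_lt_total a b : a <> b -> lex_lt a b \/ lex_lt b a.
Proof.
move=> neq; have [i0 ne0] : exists i, a i != b i.
  apply: contra_notP neq => /forallNP eqab; apply/mnmP => i.
  by apply/eqP; move/negP: (eqab i); rewrite negbK.
case: (@arg_maxnP _ i0 (fun i => a i != b i) (fun i => i : nat)) => // i ne_i max_i.
have eq_above j : (i < j)%N -> a j = b j.
  by move=> ij; apply: contraTeq ij => /max_i; rewrite -leqNgt.
have [lt|gt|eqi] := ltngtP (a i) (b i); last by rewrite eqi eqxx in ne_i.
- by left; exists i.
- by right; exists i; split=> // j /eq_above.
Qed.

Lemma lex_lt_wf : well_founded lex_lt.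
Proof.
pose lt_below k a b := exists i, [/\ (i < k)%N, (a i < b i)%N
  & forall j, (i < j)%N -> a j = b j].
suff wf_below k b : (k <= n)%N -> Acc (lt_below k) b.
  move=> b; have := wf_below n b (leqnn n).
  elim=> {}b _ IH; constructor=> a [i [ltab eqab]].
  by apply: IH; exists i.
elim: k b => [|k IHk] b lt_kn; first by constructor=> a [i []].
(* Outer induction on the k-th exponent, inner one on the exponents below. *)
pose k' := Ordinal lt_kn; have [N leN] := ubnP (b k').
elim: N => [|N IHN] in b leN *; first by rewrite ltn0 in leN.
move: leN; elim: (IHk b (ltnW lt_kn)) => {}b _ IHb leN.
constructor=> a [i [lt_ik ltab eqab]]; move: lt_ik; rewrite ltnS leq_eqVlt.
case/predU1P=> [eik|lt_ik].
  have eik' : i = k' by exact: val_inj.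
  by apply: IHN; rewrite -eik'; apply: leq_trans ltab _; rewrite eik' -ltnS.
by apply: IHb; [exists i | rewrite eqab].
Qed.

End Lex.

Lemma exists_maximal (T : eqType) (r : T -> T -> Prop) (s : seq T) :
    (forall x, ~ r x x) -> (forall x y z, r x y -> r y z -> r x z) ->
  s <> [::] -> exists2 x, x \in s & forall y, y \in s -> ~ r x y.
Proof.
move=> irr tr; elim: s => // x s IH _.
have [->|/eqP s_neq0] := eqVneq s [::].
  by exists x => [|y]; rewrite ?mem_seq1 // => /eqP->.
have [m ms max_m] := IH s_neq0.
have [rmx|nrmx] := pselect (r m x).
  exists x => [|y]; first exact: mem_head.
  rewrite inE => /predU1P[->|ys] // rxy.
  by apply: (max_m y ys); apply: tr rxy.
exists m => [|y]; first by rewrite inE ms orbT.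
by rewrite inE => /predU1P[->|/max_m].
Qed.

(** * Terms and coefficients in a free module *)

Section Coefficients.
Context {A : comNzRingType} {n : nat} {I : finType}.
Implicit Types (f g : freemod A n I) (t u : 'X_{1..n.+1} * I).

Lemma coefvP f g : coefv f =1 coefv g -> f = g.
Proof. by move=> eqfg; apply/ffunP=> k; apply/mpolyP=> a; exact: eqfg (a, k). Qed.

Lemma coefvD f g t : coefv (f + g) t = coefv f t + coefv g t.
Proof. by rewrite /coefv !ffunE mcoeffD. Qed.

Lemma coefvN f t : coefv (- f) t = - coefv f t.
Proof. by rewrite /coefv !ffunE mcoeffN. Qed.

Lemma coefvB f g t : coefv (f - g) t = coefv f t - coefv g t.
Proof. by rewrite coefvD coefvN. Qed.

Lemma coefv0 t : coefv (0 : freemod A n I) t = 0.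
Proof. by rewrite /coefv ffunE mcoeff0. Qed.

Lemma coefv_sum (J : Type) (r : seq J) (F : J -> freemod A n I) t :
  coefv (\sum_(j <- r) F j) t = \sum_(j <- r) coefv (F j) t.
Proof. exact: (big_morph (coefv ^~ t) (fun f g => coefvD f g t) (coefv0 t)). Qed.

Lemma coefvCZ (c : A) f t : coefv (c%:MP *: f) t = c * coefv f t.
Proof. by rewrite /coefv ffunE; exact: mcoeffCM. Qed.

Lemma coefvXZ a f b k : coefv ('X_[a] *: f) ((a + b)%MM, k) = coefv f (b, k).
Proof.
rewrite /coefv ffunE /= -(mcoeffMX (f k : {mpoly A[n.+1]}) a b) addmC.
by rewrite [_ * 'X_[a]]mulrC.
Qed.

Lemma coefvXZ_neq0 a f t : coefv ('X_[a] *: f) t != 0 ->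
  exists2 b, t.1 = (a + b)%MM & coefv f (b, t.2) != 0.
Proof.
case: t => b k; rewrite /coefv ffunE /= => nz.
have: b \in msupp ((f k : {mpoly A[n.+1]}) * 'X_[a]) by rewrite mcoeff_msupp mulrC.
rewrite (perm_mem (msuppMX _ _)) => /mapP[e es ->].
by exists e; rewrite -?mcoeff_msupp.
Qed.

Lemma coefv_termv t u : coefv (termv t : freemod A n I) u = (t == u)%:R.
Proof.
case: t u => a k [b l]; rewrite /coefv ffunE /= xpair_eqE [l == k]eq_sym.
by have [_|_] := eqVneq k l; rewrite ?andbT ?andbF ?mcoeffX ?mcoeff0.
Qed.

Lemma XZ_termv a t :
  'X_[a] *: termv t = termv ((a + t.1)%MM, t.2) :> freemod A n I.
Proof.
apply/ffunP=> k; rewrite !ffunE /=.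
by case: eqP => _; [exact/esym/mpolyXD | exact: scaler0].
Qed.

Definition suppv f : seq ('X_{1..n.+1} * I) :=
  [seq (a, k) | k <- enum I, a <- msupp (f k : {mpoly A[n.+1]})].

Lemma mem_suppv f t : (t \in suppv f) = (coefv f t != 0).
Proof.
rewrite -mcoeff_msupp; apply/allpairsPdep/idP => [[k [a [_ ka ->]]] //|ta].
by exists t.2, t.1; rewrite mem_enum -surjective_pairing.
Qed.

Lemma suppv_uniq f : uniq (suppv f).
Proof.
by apply: allpairs_uniq_dep => [||[k a] [l b] _ _ [-> ->]] //; exact: enum_uniq.
Qed.

Lemma coefvCtermv (c : A) t u :
  coefv (c%:MP *: termv t : freemod A n I) u = c * (t == u)%:R.
Proof. by rewrite coefvCZ coefv_termv. Qed.

Lemma freemodE f : f = \sum_(t <- suppv f) (coefv f t)%:MP *: termv t.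
Proof.
apply: coefvP => u; rewrite coefv_sum.
transitivity (\sum_(t <- suppv f | t == u) coefv f u); last first.
  rewrite big_mkcond; apply: eq_bigr => t _; rewrite [RHS]coefvCtermv.
  by case: eqP => [->|_]; rewrite ?mulr1 ?mulr0.
have [su|nsu] := boolP (u \in suppv f).
  by rewrite -big_filter filter_pred1_uniq ?suppv_uniq // big_seq1.
rewrite big_seq_cond big_pred0 => [|t].
  by move: nsu; rewrite mem_suppv negbK => /eqP.
by apply: contraNF nsu => /andP[ts /eqP<-].
Qed.

Lemma freemod_ind (W : set (freemod A n I)) f :
    W 0 -> (forall g h, W g -> W h -> W (g + h)) ->
    (forall t, coefv f t != 0 -> W ((coefv f t)%:MP *: termv t)) ->
  W f.
Proof.
move=> W0 WD Wt; rewrite (freemodE f) big_seq; apply: (big_ind W) => // t.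
by rewrite mem_suppv; exact: Wt.
Qed.

Lemma supported0 N : supported_in N (0 : freemod A n I).
Proof. by move=> t; rewrite coefv0 eqxx. Qed.

Lemma supportedD N f g :
  supported_in N f -> supported_in N g -> supported_in N (f + g).
Proof.
move=> Nf Ng t; rewrite coefvD.
have [->|/Nf //] := eqVneq (coefv f t) 0.
by rewrite add0r => /Ng.
Qed.

Lemma supportedCZ N (c : A) f : supported_in N f -> supported_in N (c%:MP *: f).
Proof.
move=> Nf t; rewrite coefvCZ => nz; apply: Nf.
by apply: contra_neq nz => ->; rewrite mulr0.
Qed.

Lemma supportedB N f g :
  supported_in N f -> supported_in N g -> supported_in N (f - g).
Proof.
by move=> Nf Ng; apply: supportedD => // t; rewrite coefvN oppr_eq0 => /Ng.
Qed.

Lemma supported_termv (N : set ('X_{1..n.+1} * I)) t :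
  N t -> supported_in N (termv t : freemod A n I).
Proof.
by move=> Nt u; rewrite coefv_termv; case: (eqVneq t u) => [<-|_] //; rewrite eqxx.
Qed.

End Coefficients.

Section LinearExtension.
Context {A : comNzRingType} {n : nat} {I J : finType}.
Variable phi : 'X_{1..n.+1} * I -> freemod A n J.
Implicit Types f g : freemod A n I.

(** Linear over A but not over the polynomial ring: the normal form modulo a
    marked set is of this kind, with [phi t] the normal form of the term t. *)
Definition linear_extension f : freemod A n J :=
  \sum_(t <- suppv f) (coefv f t)%:MP *: phi t.

Lemma linear_extension_sub f (s : seq ('X_{1..n.+1} * I)) :
    uniq s -> {subset suppv f <= s} ->
  linear_extension f = \sum_(t <- s) (coefv f t)%:MP *: phi t.
Proof.
move=> s_uniq sub; rewrite [RHS](bigID (mem (suppv f))) /= [X in _ + X]big1 ?addr0.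
  rewrite -big_filter; apply: perm_big; apply: uniq_perm.
  - exact: suppv_uniq.
  - exact: filter_uniq.
  - by move=> t; rewrite mem_filter andb_idr //; exact: sub.
by move=> t; rewrite mem_suppv negbK => /eqP->; rewrite mpolyC0 scale0r.
Qed.

Lemma linear_extensionD f g :
  linear_extension (f + g) = linear_extension f + linear_extension g.
Proof.
pose s := undup (suppv f ++ suppv g ++ suppv (f + g)).
have s_uniq : uniq s by exact: undup_uniq.
rewrite !(@linear_extension_sub _ s) //; try by
  move=> t ts; rewrite mem_undup !mem_cat ts ?orbT.
by rewrite -big_split; apply: eq_bigr => t _; rewrite coefvD mpolyCD scalerDl.
Qed.

Lemma linear_extensionCZ (c : A) f :
  linear_extension (c%:MP *: f) = c%:MP *: linear_extension f.
Proof.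
rewrite (@linear_extension_sub _ (suppv f)) ?suppv_uniq //.
  rewrite scaler_sumr; apply: eq_bigr => t _.
  by rewrite coefvCZ mpolyCM scalerA.
move=> t; rewrite !mem_suppv coefvCZ; apply: contra_neq => ->; exact: mulr0.
Qed.

Lemma linear_extension0 : linear_extension 0 = 0.
Proof. by rewrite -[0](scale0r 0) -mpolyC0 linear_extensionCZ mpolyC0 scale0r. Qed.

Lemma linear_extension_termv t : linear_extension (termv t) = phi t.
Proof.
rewrite (@linear_extension_sub _ [:: t]) //.
  by rewrite big_seq1 coefv_termv eqxx mpolyC1 scale1r.
by move=> u; rewrite mem_suppv coefv_termv mem_seq1; case: (eqVneq t u) => //; rewrite eqxx.
Qed.

End LinearExtension.

Section LinearCombinations.
Context {A : comNzRingType} {n : nat} {I J : finType}.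
Variable F : J -> freemod A n I.

Lemma lincomb_is_linear : linear (lincomb F).
Proof.
move=> p P Q; rewrite /lincomb scaler_sumr -big_split; apply: eq_bigr => j _ /=.
by rewrite !ffunE scalerDl scalerA.
Qed.

HB.instance Definition _ :=
  GRing.isLinear.Build {mpoly A[n.+1]} (freemod A n J) (freemod A n I) _
    (lincomb F) lincomb_is_linear.

Lemma lincomb0 : lincomb F 0 = 0.
Proof. exact: linear0. Qed.

Lemma lincombD P Q : lincomb F (P + Q) = lincomb F P + lincomb F Q.
Proof. exact: linearD. Qed.

Lemma lincombB P Q : lincomb F (P - Q) = lincomb F P - lincomb F Q.
Proof. exact: linearB. Qed.

Lemma lincombZ p P : lincomb F (p *: P) = p *: lincomb F P.
Proof. exact: linearZ. Qed.

Lemma lincomb_sum (K : Type) (r : seq K) (P : K -> freemod A n J) :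
  lincomb F (\sum_(k <- r) P k) = \sum_(k <- r) lincomb F (P k).
Proof. exact: linear_sum. Qed.

Lemma lincomb_termv t : lincomb F (termv t) = 'X_[t.1] *: F t.2.
Proof.
rewrite /lincomb (bigD1 t.2) //= ffunE eqxx big1 ?addr0 // => j /negPf nj.
by rewrite ffunE nj scale0r.
Qed.

Lemma lincombE P :
  lincomb F P = \sum_(t <- suppv P) (coefv P t)%:MP *: ('X_[t.1] *: F t.2).
Proof.
rewrite {1}(freemodE P) lincomb_sum; apply: eq_bigr => t _.
by rewrite lincombZ lincomb_termv.
Qed.

End LinearCombinations.

(** * Submodules and spans *)

Section Spans.
Context {R : nzRingType} {V : lmodType R}.
Implicit Types (S M : set V).

Lemma submodule_span S : submodule (span S).
Proof.
split=> [N [[N0 _ _] _]|u v uS vS N NS|a u uS N NS] //.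
- by have [[_ ND _] _] := NS; apply: ND; [exact: uS | exact: vS].
- by have [[_ _ NZ] _] := NS; apply: NZ; exact: uS.
Qed.

Lemma subset_span S : S `<=` span S.
Proof. exact: sub_smallest. Qed.

Lemma span_min S M : submodule M -> S `<=` M -> span S `<=` M.
Proof. exact: smallest_sub. Qed.

Lemma span_submodule M : submodule M -> span M = M.
Proof. exact: smallest_id. Qed.

Lemma submoduleB M u v : submodule M -> M u -> M v -> M (u - v).
Proof. by move=> [_ MD MZ] Mu Mv; apply: MD => //; rewrite -scaleN1r; exact: MZ. Qed.

End Spans.

Lemma span_range (A : comNzRingType) (n : nat) (I J : finType)
    (F : J -> freemod A n I) :
  span (range F) = range (lincomb F).
Proof.
apply/seteqP; split.
  apply: span_min; last first.
    move=> _ [j _ <-]; exists (termv (0%MM, j)) => //.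
    by rewrite lincomb_termv mpolyX0 scale1r.
  split=> [|_ _ [P _ <-] [Q _ <-]|p _ [P _ <-]].
  - by exists 0 => //; rewrite lincomb0.
  - by exists (P + Q) => //; rewrite lincombD.
  - by exists (p *: P) => //; rewrite lincombZ.
have [S0 SD SZ] := submodule_span (range F).
move=> _ [P _ <-]; rewrite /lincomb; apply: (big_ind (span (range F))) => // j _.
by apply: SZ; apply: subset_span; exists j.
Qed.

Lemma syzygies_submodule (A : comNzRingType) (n : nat) (I J : finType)
    (F : J -> freemod A n I) :
  submodule (syzygies F).
Proof.
split=> [|P Q P0 Q0|p P P0]; first exact: lincomb0.
- by rewrite /syzygies /= lincombD P0 Q0 addr0.
- by rewrite /syzygies /= lincombZ P0 scaler0.
Qed.

(** * Pommaret cones *)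

Section Cones.
Context {n : nat}.
Implicit Types (a b e : 'X_{1..n.+1}) (i j : 'I_n.+1).

Definition multiplicative_exponent a e := forall i, nonmult a i -> e i = 0%N.

Lemma nonmultP a i :
  reflect (exists2 j : 'I_n.+1, (j < i)%N & a j != 0%N) (nonmult a i).
Proof.
rewrite /nonmult /min_var; case: pickP => [j /andP[aj /forallP min_j]|none].
  apply: (iffP idP) => [ji|[k ki ak]]; first by exists j.
  by apply: leq_ltn_trans ki; exact: (implyP (min_j k)).
apply: (iffP idP) => // -[k ki ak].
case: (@arg_minnP _ k (fun j => a j != 0%N) (fun j => j : nat)) => // j aj min_j.
have /negP[] := negbT (none j); rewrite aj; apply/forallP=> l; apply/implyP; exact: min_j.
Qed.

Lemma mconeP (I : Type) (h t : 'X_{1..n.+1} * I) :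
  mcone h t <-> exists2 e, multiplicative_exponent h.1 e & t = ((e + h.1)%MM, h.2).
Proof.
split=> [[_ [e me <-] <-]|[e me ->]]; first by exists e.
by exists (e + h.1)%MM => //; exists e.
Qed.

Lemma cone_addr a e : cone a (e + a)%MM <-> multiplicative_exponent a e.
Proof.
split=> [[e' me' /(congr1 (fun b => (b - a)%MM))]|me]; last by exists e.
by rewrite !addmK => <-.
Qed.

End Cones.

Section Frames.
Context {n : nat}.
Implicit Types (L : frame n).

Definition head_cones L : set ('X_{1..n.+1} * fbas L) :=
  [set t | exists j, mcone (head j) t].

Definition normal L : set ('X_{1..n.+1} * fbas L) :=
  ~` @head_cones L.

(** The heads of a frame with these properties are the Pommaret basis of the
    monomial module whose terms fill their cones. *)
Record pommaret_heads L : Prop := PommaretHeads {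
  cones_disjoint (j j' : fidx L) (t : 'X_{1..n.+1} * fbas L) :
    mcone (head j) t -> mcone (head j') t -> j = j';
  cones_closed (a : 'X_{1..n.+1}) (t : 'X_{1..n.+1} * fbas L) :
    @head_cones L t -> @head_cones L ((a + t.1)%MM, t.2)
}.

Lemma head_cones_head L (j : fidx L) : head_cones (head j).
Proof.
exists j; apply/mconeP; exists 0%MM; first by move=> i _; rewrite mnm0E.
by rewrite add0m -surjective_pairing.
Qed.

(** Let i be the largest variable at which d and e differ. If e had the larger
    exponent there, x_i would be multiplicative, so h would involve no variable
    below x_i, and comparing exponents from x_i on shows that h divides b. *)
Lemma normal_lex_lt L (j : fidx L) (b d e : 'X_{1..n.+1}) :
    pommaret_heads L -> normal (b, (head j).2) ->
    multiplicative_exponent (head j).1 e -> (d + b = e + (head j).1)%MM ->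
  lex_lt e d.
Proof.
move=> hL nb me eq_db; set h := (head j).1 in me eq_db.
have not_dvd : ~ (h <= b)%MM.
  move=> hb; apply: nb; rewrite -(submK hb).
  exact: (cones_closed hL (b - h)%MM (head_cones_head j)).
have eqE i : (d i + b i = e i + h i)%N by rewrite -!mnmDE eq_db.
have [ed|[//|[i [lt_i eq_i]]]] : e = d \/ (lex_lt e d \/ lex_lt d e).
- by have [->|/lex_lt_total ?] := pselect (e = d); [left | right].
- by case: not_dvd; apply/mnm_lepP=> i; rewrite -(leq_add2l (d i)) eqE ed.
- case: not_dvd; apply/mnm_lepP=> k; have [ki|] := ltnP k i.
    have [->//|hk] := eqVneq (h k) 0%N.
    by rewrite (me i) in lt_i; [rewrite ltn0 in lt_i | apply/nonmultP; exists k].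
  move=> ik; rewrite -(leq_add2l (d k)) eqE leq_add2r.
  by move: ik; rewrite leq_eqVlt => /predU1P[/val_inj<-|/eq_i->//]; exact: ltnW.
Qed.

Lemma nonmult_trans (a : 'X_{1..n.+1}) (i i' : 'I_n.+1) :
  (i <= i')%N -> nonmult a i -> nonmult a i'.
Proof.
by move=> ii' /nonmultP[j ji aj]; apply/nonmultP; exists j => //; exact: leq_trans ii'.
Qed.

Lemma multiplicative_U (i : 'I_n.+1) (e : 'X_{1..n.+1}) :
  multiplicative_exponent U_(i)%MM e <-> forall k : 'I_n.+1, (i < k)%N -> e k = 0%N.
Proof.
split=> me k.
  by move=> ik; apply: me; apply/nonmultP; exists i => //; rewrite mnm1E eqxx.
case/nonmultP=> j jk; rewrite mnm1E; case: (eqVneq i j) => // eij _.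
by apply: me; rewrite eij.
Qed.

Lemma next_mconeP L (p : fidx (next_frame L)) (t : 'X_{1..n.+1} * fidx L) :
  mcone (head p) t <-> [/\ t.2 = (val p).2, t.1 (val p).1 != 0%N
    & forall k : 'I_n.+1, ((val p).1 < k)%N -> t.1 k = 0%N].
Proof.
rewrite mconeP; split=> [[e /= /multiplicative_U me ->] /=|[eq2 nz above]].
  split=> [||k ik] //; first by rewrite mnmDE mnm1E eqxx addn1.
  by rewrite mnmDE mnm1E me // -val_eqE (ltn_eqF ik).
exists (t.1 - U_((val p).1))%MM; rewrite /=.
  by apply/multiplicative_U => k ik; rewrite mnmBE above.
rewrite submK -?eq2 -?surjective_pairing //; apply/mnm_lepP=> k; rewrite mnm1E.
by case: (eqVneq _ k) => // <-; rewrite lt0n.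
Qed.

Lemma next_head_conesP L (t : 'X_{1..n.+1} * fidx L) :
  head_cones (L := next_frame L) t <->
    exists2 i, nonmult (head t.2).1 i & t.1 i != 0%N.
Proof.
split=> [[p /next_mconeP[-> nz _]]|[i nm nz]].
  by exists (val p).1 => //; exact: (valP p).
case: (@arg_maxnP _ i (fun k => t.1 k != 0%N) (fun k => k : nat)) => // l nzl max_l.
have nml : nonmult (head (l, t.2).2).1 l by apply: nonmult_trans nm; exact: max_l.
exists (exist _ (l, t.2) nml); apply/next_mconeP; split=> //= k lk.
by apply: contraTeq lk => /max_l; rewrite -leqNgt.
Qed.

(** The frame of the fundamental syzygies inherits the cone structure from the
    shape of [nonmult] alone: the largest variable of x^a singles out the cone
    of x^a f_j, and multiples of a term with a non-multiplicative variable keep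
    that variable. *)
Lemma pommaret_heads_next L : pommaret_heads (next_frame L).
Proof.
split=> [p q t /next_mconeP[p2 p1 p_max] /next_mconeP[q2 q1 q_max]|a t].
  apply: val_inj; case: (val p) (val q) p2 p1 p_max q2 q1 q_max => [i j] [i' j'] /=.
  move=> -> ti max_i ->  ti' max_i'; congr (_, _); apply/val_inj/eqP.
  rewrite eqn_leq; apply/andP; split; rewrite leqNgt.
  - by apply: contra_neqN ti => /max_i'.
  - by apply: contra_neqN ti' => /max_i.
move=> /next_head_conesP[i nm nz]; apply/next_head_conesP; exists i => //=.
by rewrite mnmDE addn_eq0 negb_and nz orbT.
Qed.

Lemma normal_nextP L (t : 'X_{1..n.+1} * fidx L) :
  normal (L := next_frame L) t <-> multiplicative_exponent (head t.2).1 t.1.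
Proof.
split=> [nt i nm|me /next_head_conesP[i /me ti0]]; last by rewrite ti0.
by apply: contra_notP nt => /eqP nz; apply/next_head_conesP; exists i.
Qed.

End Frames.

(** * Marked bases over a frame *)

Section MarkedSets.
Context {A : comNzRingType} {n : nat} (L : frame n).
Implicit Types (F : fidx L -> freemod A n (fbas L)) (P Q : freemod A n (fidx L)).

Lemma multiplicativeE P :
  multiplicative P <-> supported_in (normal (L := next_frame L)) P.
Proof.
split=> [mP [a j] /mP /cone_addr me|nP j a nz]; first exact/normal_nextP.
by apply/cone_addr; exact/(normal_nextP (a, j))/nP.
Qed.

Definition marked F := forall j, supported_in (@normal _ L) (F j - termv (head j)).

Lemma coefv_XZ_marked F a j (t : 'X_{1..n.+1} * fbas L) :
    marked F -> coefv ('X_[a] *: F j) t != 0 ->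
    t = ((a + (head j).1)%MM, (head j).2) \/
    exists2 b, t.1 = (a + b)%MM & normal (b, t.2).
Proof.
move=> mF; rewrite -(subrK (termv (head j)) (F j)) scalerDr XZ_termv coefvD.
rewrite coefv_termv; case: (eqVneq _ t) => [<-|_]; first by left.
by rewrite addr0 => /coefvXZ_neq0[b -> nz]; right; exists b => //; exact: (mF j).
Qed.

Hypothesis hL : pommaret_heads L.

(** Reduction: replacing a term x^d x^h of a cone by the multiplicative multiple
    of the corresponding marked element produces terms that are normal or have a
    lexicographically smaller multiplier d, so that it terminates. *)
Lemma marked_decomposition F (f : freemod A n (fbas L)) : marked F ->
  exists P g, [/\ multiplicative P, supported_in (@normal _ L) g & f = lincomb F P + g].
Proof.
move=> mF; pose W : set (freemod A n (fbas L)) := [set f | exists P g,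
  [/\ multiplicative P, supported_in (@normal _ L) g & f = lincomb F P + g]].
have W0 : W 0.
  exists 0, 0; split; last by rewrite lincomb0 addr0.
  - by apply/multiplicativeE; exact: supported0.
  - exact: supported0.
have WD g h : W g -> W h -> W (g + h).
  move=> [P [u [/multiplicativeE mP nu ->]]] [Q [v [/multiplicativeE mQ nv ->]]].
  exists (P + Q), (u + v); split; [apply/multiplicativeE | | ]; [exact: supportedD.. | ].
  by rewrite lincombD addrACA.
have WZ (c : A) g : W g -> W (c%:MP *: g).
  move=> [P [u [/multiplicativeE mP nu ->]]]; exists (c%:MP *: P), (c%:MP *: u).
  split; [apply/multiplicativeE | | ]; [exact: supportedCZ.. | ].
  by rewrite lincombZ scalerDr.
have Wnormal t : normal t -> W (termv t).
  move=> nt; exists 0, (termv t); split; last by rewrite lincomb0 add0r.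
  - by apply/multiplicativeE; exact: supported0.
  - exact: supported_termv.
have Wcone d j : multiplicative_exponent (head j).1 d ->
    W (termv ((d + (head j).1)%MM, (head j).2)).
  elim/(well_founded_ind (@lex_lt_wf n.+1)): d j => d IH j md.
  rewrite -XZ_termv -[termv _](subKr (F j)) scalerBr; apply: (WD).
    exists (termv (d, j)), 0; split; last by rewrite lincomb_termv addr0.
    - by apply/multiplicativeE; apply: supported_termv; apply/normal_nextP.
    - exact: supported0.
  rewrite -scalerN opprB; apply: (freemod_ind W0 WD) => t /coefvXZ_neq0[b t1 nz]; apply: (WZ).
  have nb : normal (b, t.2).
    by apply: (mF j); move: nz; rewrite -opprB coefvN oppr_eq0.
  have [[j' /mconeP[e me et]]|] := pselect (head_cones t); last exact: Wnormal.
  rewrite et; apply: IH => //; apply: (normal_lex_lt (b := b) (d := d) hL) me _.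
    by rewrite et in nb.
  by rewrite -t1 et.
apply: (freemod_ind W0 WD) => t _; apply: (WZ).
have [[j /mconeP[e me ->]]|] := pselect (head_cones t); last exact: Wnormal.
exact: Wcone.
Qed.

(** Among the multipliers in P, let d be lexicographically maximal, at f_j. Then
    no other summand of the combination contributes to the term x^d x^h, where
    x^h is the head of f_j: heads lie in disjoint cones, and a tail could reach
    this term only with a multiplier larger than d. *)
Lemma multiplicative_normal_eq0 F P :
  marked F -> multiplicative P -> supported_in (@normal _ L) (lincomb F P) -> P = 0.
Proof.
move=> mF /multiplicativeE mP nFP; apply/eqP; apply: contraT => P_neq0.
have s_neq0 : [seq t.1 | t <- suppv P] <> [::].
  move=> s0; case/eqP: P_neq0; rewrite (freemodE P).
  by have /eqP := congr1 size s0; rewrite size_map => /nilP->; rewrite big_nil.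
have [d /mapP[[d' j] sdj /= ->{d}] max_d] :=
  exists_maximal (@lex_ltxx _) (@lex_lt_trans _) s_neq0.
move: d' => d in sdj max_d *.
have md : multiplicative_exponent (head j).1 d.
  by apply: (normal_nextP (d, j)).1; apply: mP; rewrite -mem_suppv.
pose t : 'X_{1..n.+1} * fbas L := ((d + (head j).1)%MM, (head j).2).
have cone_t : mcone (head j) t by apply/mconeP; exists d.
have others u : u \in suppv P -> u != (d, j) -> coefv ('X_[u.1] *: F u.2) t = 0.
  move=> su neq; apply/eqP; apply: contraT => /(coefv_XZ_marked mF)[eq_t|[b /= eq_t nb]].
    have mu : multiplicative_exponent (head u.2).1 u.1.
      by apply/normal_nextP/mP; rewrite -mem_suppv.
    have cone_u : mcone (head u.2) t by apply/mconeP; exists u.1.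
    have eq_j := cones_disjoint hL cone_t cone_u; case/eqP: neq.
    have := congr1 (fun v => v.1 - (head j).1)%MM eq_t.
    by rewrite /= -eq_j !addmK => ->; rewrite eq_j -surjective_pairing.
  case: (max_d u.1); first exact: map_f.
  exact: (normal_lex_lt hL nb md (esym eq_t)).
have own : coefv ('X_[d] *: F j) t = 1.
  rewrite -(subrK (termv (head j)) (F j)) scalerDr XZ_termv coefvD coefv_termv eqxx.
  rewrite coefvXZ.
  have [->|/(mF j)[]] := eqVneq (coefv (F j - termv (head j)) ((head j).1, (head j).2)) 0.
    by rewrite add0r.
  by rewrite -surjective_pairing; exact: head_cones_head.
have: coefv (lincomb F P) t = coefv P (d, j).
  rewrite lincombE coefv_sum (bigD1_seq (d, j) sdj (suppv_uniq P)) /=.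
  rewrite [X in X + _ = _]coefvCZ own mulr1 big1_seq ?addr0 // => u /andP[neq su].
  by rewrite [LHS]coefvCZ others ?mulr0.
move: sdj; rewrite mem_suppv => nz eq_c; case: (nFP t); last by exists j.
by rewrite eq_c.
Qed.

End MarkedSets.

(** Together with [marked_decomposition], the second condition says that the
    free module is the direct sum of (F) and the span of the normal terms. *)
Definition frame_basis (A : comNzRingType) (n : nat) (L : frame n)
    (F : fidx L -> freemod A n (fbas L)) : Prop :=
  marked F /\
  forall P, supported_in (@normal _ L) (lincomb F P) -> lincomb F P = 0.

Section FrameBases.
Context {A : comNzRingType} {n : nat} (L : frame n).
Implicit Types (F : fidx L -> freemod A n (fbas L)) (P Q : freemod A n (fidx L)).

Hypothesis hL : pommaret_heads L.

Lemma multiplicative_rewriting F P : frame_basis F ->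
  exists2 Q, multiplicative Q & lincomb F P = lincomb F Q.
Proof.
move=> [mF FN0]; have [Q [g [mQ ng eqP]]] := marked_decomposition hL (lincomb F P) mF.
exists Q; first exact: mQ.
apply: subr0_eq; rewrite -(lincombB F P Q); apply: FN0.
by rewrite lincombB eqP addrC addKr.
Qed.

Lemma multiplicative_inj F P Q : marked F -> multiplicative P -> multiplicative Q ->
  lincomb F P = lincomb F Q -> P = Q.
Proof.
move=> mF /multiplicativeE mP /multiplicativeE mQ eqPQ; apply: subr0_eq.
apply: (multiplicative_normal_eq0 hL mF); first by apply/multiplicativeE; exact: supportedB.
by rewrite lincombB eqPQ subrr; exact: supported0.
Qed.

Lemma fundamental_syzygies_exist F : frame_basis F ->
  exists G, @fundamental_syzygies A n L F G.
Proof.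
move=> bF; suff /choice[G fG] : forall p : fidx (next_frame L), exists g,
    exists P, [/\ multiplicative P, 'X_((val p).1) *: F (val p).2 = lincomb F P
      & g = termv (U_((val p).1)%MM, (val p).2) - P] by exists G.
move=> p; have [P mP eqP] :=
  multiplicative_rewriting (termv (U_((val p).1)%MM, (val p).2)) bF.
exists (termv (U_((val p).1)%MM, (val p).2) - P), P; split; [exact: mP| |reflexivity].
by rewrite -eqP lincomb_termv.
Qed.

Lemma fundamental_syzygies_unique F G G' : marked F ->
  @fundamental_syzygies A n L F G -> @fundamental_syzygies A n L F G' -> G = G'.
Proof.
move=> mF fG fG'; apply/funext => p.
have [P [mP eqP ->]] := fG p; have [P' [mP' eqP' ->]] := fG' p.
by congr (_ - _); exact: multiplicative_inj mF mP mP' (etrans (esym eqP) eqP').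
Qed.

(** The normal terms of the next frame span the multiplicative combinations, and
    no nonzero one of these is a syzygy: so the fundamental syzygies are a marked
    basis, and subtracting combinations of them reduces every syzygy to zero. *)
Lemma fundamental_syzygies_basis (F : fidx L -> freemod A n (fbas L))
    (G : fidx (next_frame L) -> freemod A n (fidx L)) :
    frame_basis F -> fundamental_syzygies F G ->
  frame_basis (L := next_frame L) G /\ syzygies F = span (range G).
Proof.
move=> [mF FN0] fG.
have mG : marked (L := next_frame L) G.
  move=> p; have [P [/multiplicativeE mP _ ->]] := fG p.
  by rewrite addrAC subrr sub0r -[- P]add0r; apply: supportedB mP; exact: supported0.
have syzG (P : freemod A n (fidx (next_frame L))) : lincomb F (lincomb G P) = 0.
  rewrite {2}/lincomb lincomb_sum big1 // => p _.
  have [Q [_ eqQ ->]] := fG p.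
  by rewrite lincombZ lincombB lincomb_termv -eqQ subrr scaler0.
have normal0 Q : supported_in (@normal _ (next_frame L)) Q -> lincomb F Q = 0 -> Q = 0.
  move=> /multiplicativeE mQ FQ0; apply: (multiplicative_normal_eq0 hL mF mQ).
  by rewrite FQ0; exact: supported0.
split; first by split=> // P nP; apply: normal0.
rewrite span_range; apply/seteqP; split=> [P FP0|_ [P _ <-]]; last exact: syzG.
have [Q [g [_ ng eqP]]] := marked_decomposition (pommaret_heads_next L) P mG.
have g0 : g = 0.
  apply: normal0 ng _; rewrite -[g](addKr (lincomb G Q)) -eqP addrC lincombB syzG subr0.
  exact: FP0.
by exists Q; rewrite // eqP g0 addr0.
Qed.

End FrameBases.

(** * Extension of scalars *)

Section ScalarExtension.
Context {A B : comNzRingType} {n : nat} (s : {rmorphism A -> B}).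

Section Maps.
Context {I : finType}.
Implicit Types (f g : freemod A n I) (t : 'X_{1..n.+1} * I).

Lemma map_freemodB f g : map_freemod s (f - g) = map_freemod s f - map_freemod s g.
Proof. by apply/ffunP=> k; rewrite !ffunE raddfB. Qed.

Lemma map_freemodZ (p : {mpoly A[n.+1]}) f :
  map_freemod s (p *: f) = map_mpoly s p *: map_freemod s f.
Proof. by apply/ffunP=> k; rewrite !ffunE; exact: rmorphM. Qed.

Lemma map_freemod_sum (J : Type) (r : seq J) (F : J -> freemod A n I) :
  map_freemod s (\sum_(j <- r) F j) = \sum_(j <- r) map_freemod s (F j).
Proof.
apply: (big_morph (map_freemod s)) => [f g|]; apply/ffunP=> k; rewrite !ffunE.
- by rewrite raddfD.
- by rewrite raddf0.
Qed.

Lemma coefv_map f t : coefv (map_freemod s f) t = s (coefv f t).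
Proof. by rewrite /coefv ffunE mcoeff_map_mpoly. Qed.

Lemma map_freemod_termv t : map_freemod s (termv t) = termv t.
Proof. by apply: coefvP => u; rewrite coefv_map !coefv_termv rmorph_nat. Qed.

Lemma map_freemodCZ (c : A) f :
  map_freemod s (c%:MP *: f) = (s c)%:MP *: map_freemod s f.
Proof. by rewrite map_freemodZ map_mpolyC. Qed.

Lemma map_freemodXZ a f : map_freemod s ('X_[a] *: f) = 'X_[a] *: map_freemod s f.
Proof. by rewrite map_freemodZ map_mpolyX. Qed.

Lemma supported_map (N : set ('X_{1..n.+1} * I)) f :
  supported_in N f -> supported_in N (map_freemod s f).
Proof.
by move=> Nf t; rewrite coefv_map => nz; apply: Nf; apply: contra_neq nz => ->; exact: rmorph0.
Qed.

Lemma suppv_map f : {subset suppv (map_freemod s f) <= suppv f}.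
Proof.
move=> t; rewrite !mem_suppv coefv_map; apply: contra_neq => ->; exact: rmorph0.
Qed.

Lemma map_lincomb (J : finType) (F : J -> freemod A n I) (P : freemod A n J) :
  map_freemod s (lincomb F P) = lincomb (map_freemod s \o F) (map_freemod s P).
Proof.
rewrite /lincomb map_freemod_sum; apply: eq_bigr => j _.
by rewrite map_freemodZ ffunE.
Qed.

End Maps.

Lemma map_linear_extension (I J : finType)
    (phi : 'X_{1..n.+1} * I -> freemod A n J) (f : freemod A n I) :
  map_freemod s (linear_extension phi f) =
    linear_extension (map_freemod s \o phi) (map_freemod s f).
Proof.
rewrite (linear_extension_sub _ (suppv_uniq f) (@suppv_map _ f)) /linear_extension map_freemod_sum.
by apply: eq_bigr => t _; rewrite map_freemodCZ coefv_map.
Qed.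

Section FrameMaps.
Variable L : frame n.
Implicit Types F : fidx L -> freemod A n (fbas L).

Lemma fundamental_syzygies_map F (G : fidx (next_frame L) -> freemod A n (fidx L)) :
    fundamental_syzygies F G ->
  @fundamental_syzygies B n L (map_freemod s \o F) (map_freemod s \o G).
Proof.
move=> fG p; have [P [/multiplicativeE mP eqP eqG]] := fG p.
exists (map_freemod s P); split.
- by apply/multiplicativeE; exact: supported_map.
- by rewrite -map_lincomb -eqP map_freemodXZ.
- by rewrite /= eqG map_freemodB map_freemod_termv.
Qed.

Hypothesis hL : pommaret_heads L.

(** The normal form of f, the unique normal element congruent to f modulo (F),
    depends A-linearly on f. Its extension to B kills the combinations of the
    images of F and fixes the normal elements, so that only 0 is both. *)
Lemma frame_basis_map F : frame_basis F -> frame_basis (map_freemod s \o F).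
Proof.
move=> [mF FN0]; split=> [j|].
  by rewrite /= -map_freemod_termv -map_freemodB; exact: supported_map.
have /choice[nf nfP] : forall t, exists g, supported_in (@normal _ L) g /\
    exists P, termv t - g = lincomb F P.
  move=> t; have [P [g [_ ng eq_t]]] := marked_decomposition hL (termv t) mF.
  by exists g; split=> //; exists P; rewrite eq_t addrK.
have nf_normal f : supported_in (@normal _ L) (linear_extension nf f).
  rewrite /linear_extension; apply: big_ind.
  - exact: supported0.
  - exact: supportedD.
  - by move=> t _; apply: supportedCZ; have [] := nfP t.
have nf_congr f : exists P, f - linear_extension nf f = lincomb F P.
  apply: (freemod_ind (W := [set f | exists P, f - linear_extension nf f = lincomb F P])).
  - by exists 0; rewrite linear_extension0 subrr lincomb0.
  - move=> g h [P eqP] [Q eqQ]; exists (P + Q).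
    by rewrite lincombD -eqP -eqQ linear_extensionD opprD addrACA.
  - move=> t _; have [_ [P eqP]] := nfP t; exists ((coefv f t)%:MP *: P).
    by rewrite lincombZ -eqP linear_extensionCZ linear_extension_termv scalerBr.
have nf_span P : linear_extension nf (lincomb F P) = 0.
  have [Q eqQ] := nf_congr (lincomb F P).
  have eq_nf : linear_extension nf (lincomb F P) = lincomb F (P - Q).
    by rewrite lincombB -eqQ subKr.
  by rewrite eq_nf; apply: FN0; rewrite -eq_nf.
have nf_id t : normal t -> nf t = termv t.
  move=> nt; have [ng [P eqP]] := nfP t; apply/esym/subr0_eq; rewrite eqP.
  by apply: FN0; rewrite -eqP; apply: supportedB => //; exact: supported_termv.
move=> P nP; rewrite -[RHS](_ : linear_extension (map_freemod s \o nf)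
    (lincomb (map_freemod s \o F) P) = 0).
  rewrite {1}(freemodE (lincomb _ P)); apply: eq_big_seq => t.
  rewrite mem_suppv => /nP nt; congr (_ *: _); rewrite /= (nf_id t nt).
  exact/esym/map_freemod_termv.
apply: (freemod_ind (W := [set P | linear_extension (map_freemod s \o nf)
    (lincomb (map_freemod s \o F) P) = 0])) => /=.
- by rewrite lincomb0 linear_extension0.
- by move=> Q Q' Q0 Q'0; rewrite lincombD linear_extensionD [X in X + _]Q0 [X in _ + X]Q'0 addr0.
- move=> [a j] _; rewrite lincombZ linear_extensionCZ lincomb_termv /= -map_freemodXZ.
  rewrite -map_linear_extension -[_ *: F j](lincomb_termv F (a, j)) nf_span.
  by rewrite -(subrr 0) map_freemodB subrr scaler0.
Qed.

(** Both syzygy modules are generated by fundamental syzygies, and those over B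
    are the images of those over A. *)
Lemma base_change_syzygies F : frame_basis F ->
  base_change s (syzygies F) = syzygies (map_freemod s \o F).
Proof.
move=> bF; have [G fG] := fundamental_syzygies_exist hL bF.
have [_ ->] := fundamental_syzygies_basis hL bF fG.
have [_ ->] := fundamental_syzygies_basis hL (frame_basis_map bF) (fundamental_syzygies_map fG).
by rewrite base_change_span image_comp.
Qed.

End FrameMaps.
End ScalarExtension.

(** * Homogeneous components *)

Section Grading.
Context {A : comNzRingType} {n : nat} {I : finType} (d : I -> int).
Implicit Types (f g : freemod A n I) (t : 'X_{1..n.+1} * I).

Lemma coefv_hcomp r f t :
  coefv (hcomp d r f) t = if tdeg d t == r then coefv f t else 0.
Proof.
case: t => b k; rewrite {1}/coefv ffunE /= raddf_sum.
transitivity (\sum_(a <- msupp (f k : {mpoly A[n.+1]}) | a == b)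
                if tdeg d (b, k) == r then coefv f (b, k) else 0).
  rewrite big_mkcond [RHS]big_mkcond; apply: eq_bigr => a _ /=.
  have [->|neq] := eqVneq a b; first by rewrite mcoeffZ mcoeffX eqxx mulr1.
  by case: ifP => // _; rewrite mcoeffZ mcoeffX (negPf neq) mulr0.
have [sb|nsb] := boolP (b \in msupp (f k : {mpoly A[n.+1]})).
  by rewrite -big_filter filter_pred1_uniq ?msupp_uniq // big_seq1.
rewrite big_seq_cond big_pred0 => [|a].
  by rewrite [coefv f _](memN_msupp_eq0 nsb) if_same.
by apply: contraNF nsb => /andP[sa /eqP<-].
Qed.

Lemma hcompD r f g : hcomp d r (f + g) = hcomp d r f + hcomp d r g.
Proof.
apply: coefvP => t; rewrite coefvD !coefv_hcomp coefvD.
by case: ifP => // _; rewrite addr0.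
Qed.

Lemma hcomp0 r : hcomp d r (0 : freemod A n I) = 0.
Proof. by apply: coefvP => t; rewrite coefv_hcomp coefv0 if_same. Qed.

Lemma homogeneous_hcomp r f : homogeneous d r (hcomp d r f).
Proof. by move=> t; rewrite coefv_hcomp; case: ifP => [/eqP //|_]; rewrite eqxx. Qed.

Lemma hcomp_homogeneous q r f : homogeneous d q f ->
  hcomp d r f = if q == r then f else 0.
Proof.
move=> hf; apply: coefvP => t; rewrite coefv_hcomp.
have [ft0|/hf->] := eqVneq (coefv f t) 0; last by case: (q == r); rewrite ?coefv0.
by rewrite ft0 if_same; case: (q == r); rewrite ?coefv0.
Qed.

Lemma supported_hcomp N r f : supported_in N f -> supported_in N (hcomp d r f).
Proof.
by move=> Nf t; rewrite coefv_hcomp; case: ifP => [_ /Nf|_] //; rewrite eqxx.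
Qed.

Lemma homogeneous_termv t : homogeneous d (tdeg d t) (termv t : freemod A n I).
Proof.
by move=> u; rewrite coefv_termv; case: (eqVneq t u) => [->|_] //; rewrite eqxx.
Qed.

Lemma homogeneousCXZ (c : A) a r f : homogeneous d r f ->
  homogeneous d ((mdeg a)%:Z + r) (c%:MP *: ('X_[a] *: f)).
Proof.
move=> hf [b k]; rewrite coefvCZ => nz.
have [|e /= -> /hf <-] := @coefvXZ_neq0 _ _ _ a f (b, k).
  by apply: contra_neq nz => ->; rewrite mulr0.
by rewrite /tdeg /= mdegD PoszD addrA.
Qed.

(** A combination of homogeneous elements splits into multiples by single terms,
    each of which lives in one degree. *)
Lemma graded_span (J : finType) (F : J -> freemod A n I) :
  (forall j, exists r, homogeneous d r (F j)) -> graded d (span (range F)).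
Proof.
move=> hF f r; rewrite span_range => -[P _ <-].
have [S0 SD SZ] := submodule_span (range F).
rewrite -span_range; apply: (freemod_ind
  (W := [set P | span (range F) (hcomp d r (lincomb F P))])) => /=.
- by rewrite lincomb0 hcomp0.
- by move=> Q Q' SQ SQ'; rewrite lincombD hcompD; exact: SD.
move=> [a j] _; rewrite lincombZ lincomb_termv /=.
have [q hFj] := hF j.
have SFj : span (range F) (F j) by apply: subset_span; exists j.
rewrite (@hcomp_homogeneous ((mdeg a)%:Z + q)); last exact: homogeneousCXZ.
by case: ifP => // _; apply: (SZ); apply: (SZ).
Qed.

End Grading.

Lemma homogeneous_map (A B : comNzRingType) (s : {rmorphism A -> B}) (n : nat)
    (I : finType) (d : I -> int) r (f : freemod A n I) :
  homogeneous d r f -> homogeneous d r (map_freemod s f).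
Proof.
by move=> hf t; rewrite coefv_map => nz; apply: hf; apply: contra_neq nz => ->; exact: rmorph0.
Qed.

(** * Marked bases over a quasi-stable module *)

Section QuasiStableFrames.
Context {K : fieldType} {n m : nat} {U : set (freemod K n 'I_m)}.
Hypothesis hU : quasi_stable U.

Local Notation fr := (pommaret_frame U).

Lemma pommaretP : pommaret_basis U (pommaret U).
Proof. exact: xgetPex. Qed.

Lemma head_cones_pommaret : @head_cones n (fr 0) = terms_in U.
Proof.
have [_ [<- _ _]] := pommaretP.
apply/seteqP; split=> [t [j tj]|t [u Pu tu]]; first by exists (val j) => //; exact: valP.
by exists (FSetSub Pu).
Qed.

Lemma normal_pommaret : @normal n (fr 0) = normal_terms U.
Proof. by rewrite /normal head_cones_pommaret. Qed.

Lemma pommaret_heads_frame t : pommaret_heads (fr t).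
Proof.
elim: t => [|t IH]; last exact: pommaret_heads_next.
have [eqU [_ triv _]] := pommaretP.
split=> [j j' t tj tj'|a t].
  exact/val_inj/(triv (val j) (val j') (valP j) (valP j'))/(ex_intro _ t (conj tj tj')).
rewrite head_cones_pommaret /terms_in /= -XZ_termv.
have [_ _ UZ] : submodule U by rewrite eqU; exact: submodule_span.
exact: UZ.
Qed.

Lemma head_not_normal j : ~ normal_terms U (head (f := fr 0) j).
Proof. by rewrite -normal_pommaret => nj; apply: nj; exact: head_cones_head. Qed.

End QuasiStableFrames.

Section MarkedBases.
Context {K : fieldType} {n m : nat} {d : 'I_m -> int} {U : set (freemod K n 'I_m)}.
Hypothesis hU : quasi_stable U.

Local Notation fr := (pommaret_frame U).

Section OverRing.
Context {A : comNzRingType}.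
Implicit Types (M : set (freemod A n 'I_m)) (F : fidx (fr 0) -> freemod A n 'I_m).

Lemma marked_set_marked F : marked_set d F -> marked (L := fr 0) F.
Proof. by move=> mF j; rewrite normal_pommaret //; have [] := mF j. Qed.

Lemma marked_basis_frame F M : marked_basis d F M -> frame_basis (L := fr 0) F.
Proof.
move=> [mF _ [cap0 _]]; split=> [|P]; first exact: marked_set_marked.
rewrite normal_pommaret // => nP.
have: (span (range F) `&` supported_in (normal_terms U)) (lincomb F P).
  by split=> //; rewrite span_range; exists P.
by rewrite cap0.
Qed.

Lemma frame_marked_basis F :
  marked_set d F -> frame_basis (L := fr 0) F -> marked_basis d F (span (range F)).
Proof.
move=> mF [mF' FN0]; split; [exact: mF | reflexivity | split].
  apply/seteqP; split=> [f [] | _ ->]; last first.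
    by split; [have [] := submodule_span (range F) | exact: supported0].
  by rewrite span_range => -[P _ <-] nP; apply: FN0; rewrite normal_pommaret.
move=> f; have [P [g [_ ng ->]]] := marked_decomposition (pommaret_heads_frame hU 0) f mF'.
exists (lincomb F P), g; split=> //; last by rewrite -normal_pommaret.
by rewrite span_range; exists P.
Qed.

Lemma marked_basis_Mf F M : marked_basis d F M -> Mf_set d U M.
Proof.
move=> [mF -> dec]; split=> //; first exact: submodule_span.
by apply: graded_span => j; have [] := mF j.
Qed.

(** The element with head x^a e_k is the component of degree |a| + d_k of the
    projection of the head to M along the normal terms. *)
Lemma Mf_marked_basis M : Mf_set d U M -> exists F, marked_basis d F M.
Proof.
move=> [subM grM [cap0 dec]].
have /choice[F FP] : forall j : fidx (fr 0), exists f, [/\ M f,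
    homogeneous d (tdeg d (head j)) f
    & supported_in (normal_terms U) (f - termv (head j))].
  move=> j; have [u [v [Mu nv eq_uv]]] := dec (termv (head j)).
  exists (hcomp d (tdeg d (head j)) u); split; [exact: grM | exact: homogeneous_hcomp|].
  have {1}-> : termv (head j) = hcomp d (tdeg d (head j)) (u + v).
    rewrite -eq_uv (@hcomp_homogeneous _ _ _ _ (tdeg d (head j))) ?eqxx //.
    exact: homogeneous_termv.
  rewrite hcompD opprD addrA subrr sub0r -[- _]add0r.
  by apply: supportedB; [exact: supported0 | exact: supported_hcomp].
have mF : marked_set d F.
  move=> j; have [_ hFj nFj] := FP j; split=> //; first by exists (tdeg d (head j)).
  have [zero|/nFj/(head_not_normal hU) //] :=
    eqVneq (coefv (F j - termv (head j)) (head j)) 0.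
  by apply: subr0_eq; rewrite -zero coefvB coefv_termv eqxx.
have mF' := marked_set_marked mF.
have subF : span (range F) `<=` M.
  by apply: span_min => // _ [j _ <-]; have [] := FP j.
have eqM : M = span (range F).
  apply/seteqP; split=> // f Mf.
  have [P [g [_ ng eq_f]]] := marked_decomposition (pommaret_heads_frame hU 0) f mF'.
  have FP' : span (range F) (lincomb F P) by rewrite span_range; exists P.
  have : (M `&` supported_in (normal_terms U)) g.
    split; last by rewrite -normal_pommaret.
    have -> : g = f - lincomb F P by rewrite eq_f addrC addKr.
    by apply: submoduleB => //; exact: subF.
  by rewrite cap0 => g0; rewrite eq_f g0 addr0.
by exists F; split=> //; rewrite -eqM.
Qed.

(** Two marked elements with the same head differ by a normal element, which
    lies in M. *)
Lemma marked_basis_unique F F' M : submodule M ->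
  marked_basis d F M -> marked_basis d F' M -> F = F'.
Proof.
move=> subM [mF eqM [cap0 _]] [mF' eqM' _]; apply/funext => j.
apply: subr0_eq; move: cap0; rewrite -eqM => cap0.
have : (M `&` supported_in (normal_terms U)) (F j - F' j).
  split.
    by apply: submoduleB => //; [rewrite eqM | rewrite eqM']; apply: subset_span; exists j.
  have -> : F j - F' j = (F j - termv (head j)) - (F' j - termv (head j)).
    by rewrite opprB addrA subrK.
  by apply: supportedB; [have [] := mF j | have [] := mF' j].
by rewrite cap0.
Qed.

End OverRing.

Lemma marked_basis_map (A B : comNzRingType) (s : {rmorphism A -> B})
    (F : fidx (fr 0) -> freemod A n 'I_m) M :
  marked_basis d F M -> marked_basis d (map_freemod s \o F) (base_change s M).
Proof.
move=> mbF; have [mF -> _] := mbF; rewrite base_change_span image_comp.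
apply: frame_marked_basis; last first.
  exact: (frame_basis_map s (pommaret_heads_frame hU 0) (marked_basis_frame mbF)).
move=> j; have [[r hFj] Fj1 nFj] := mF j; split.
- by exists r; exact: homogeneous_map.
- by rewrite /= coefv_map Fj1 rmorph1.
- by rewrite /= -(map_freemod_termv s) -map_freemodB; exact: supported_map.
Qed.

End MarkedBases.

(** * Iterated fundamental syzygies *)

Section Resolutions.
Context {n : nat} (L : frame n).
Hypothesis hL : pommaret_heads L.

Local Notation fr t := (iter t (@next_frame n) L).

Definition resolution (A : comNzRingType)
    (F : forall t, fidx (fr t) -> freemod A n (fbas (fr t))) : Prop :=
  forall t, @fundamental_syzygies A n (fr t) (F t) (F t.+1).

Lemma pommaret_heads_iter t : pommaret_heads (fr t).
Proof. by case: t => [|t]; [exact: hL | exact: pommaret_heads_next]. Qed.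

Lemma resolution_basis (A : comNzRingType)
    (F : forall t, fidx (fr t) -> freemod A n (fbas (fr t))) t :
  frame_basis (F 0) -> resolution F -> frame_basis (F t).
Proof.
move=> bF resF; elim: t => [//|t bFt].
by have [] := fundamental_syzygies_basis (pommaret_heads_iter t) bFt (resF t).
Qed.

(** Each step is available only over a marked basis, so the recursion carries
    along the proof that the level reached is one. *)
Lemma resolution_exists (A : comNzRingType) (F0 : fidx L -> freemod A n (fbas L)) :
  frame_basis F0 -> exists F : forall t, fidx (fr t) -> freemod A n (fbas (fr t)),
    F 0 = F0 /\ resolution F.
Proof.
move=> bF0; pose B t := {F : fidx (fr t) -> freemod A n (fbas (fr t)) | frame_basis F}.
have step t (b : B t) : {b' : B t.+1 | @fundamental_syzygies A n (fr t) (sval b) (sval b')}.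
  have [G fG] := cid (fundamental_syzygies_exist (pommaret_heads_iter t) (svalP b)).
  by exists (exist _ G (fundamental_syzygies_basis (pommaret_heads_iter t) (svalP b) fG).1).
pose b := nat_rect B (exist _ F0 bF0) (fun t bt => sval (step t bt)).
by exists (fun t => sval (b t)); split=> // t; exact: svalP (step t (b t)).
Qed.

Lemma resolution_unique (A : comNzRingType)
    (F F' : forall t, fidx (fr t) -> freemod A n (fbas (fr t))) t :
  frame_basis (F 0) -> F 0 = F' 0 -> resolution F -> resolution F' -> F t = F' t.
Proof.
move=> bF eq0 resF resF'; elim: t => [//|t eqt].
have [mF _] := resolution_basis t bF resF.
by apply: (fundamental_syzygies_unique (pommaret_heads_iter t) mF (resF t)); rewrite eqt.
Qed.

Lemma resolution_map (A B : comNzRingType) (s : {rmorphism A -> B})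
    (F : forall t, fidx (fr t) -> freemod A n (fbas (fr t))) :
  resolution F -> resolution (fun t => map_freemod s \o F t).
Proof. by move=> resF t; exact: fundamental_syzygies_map. Qed.

End Resolutions.

(** * Functoriality *)

Section BaseChangeLaws.
Context {n : nat} {I : finType}.

Lemma base_change_id (A : comNzRingType) (M : set (freemod A n I)) :
  submodule M -> base_change idfun M = M.
Proof.
move=> subM; rewrite /base_change (_ : map_freemod idfun = id).
  by rewrite image_id span_submodule.
apply/funext => f; apply/ffunP=> k; rewrite ffunE.
by apply/mpolyP => a; rewrite mcoeff_map_mpoly.
Qed.

Lemma base_change_comp (A B C : comNzRingType) (s : {rmorphism A -> B})
    (t : {rmorphism B -> C}) (M : set (freemod A n I)) :
  base_change (t \o s) M = base_change t (base_change s M).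
Proof.
rewrite [base_change s M]/base_change base_change_span image_comp [LHS]/base_change.
congr (span (_ @` M)); apply/funext => f; apply/ffunP=> k; rewrite !ffunE.
by apply/mpolyP => a; rewrite !mcoeff_map_mpoly.
Qed.

End BaseChangeLaws.

Section Functoriality.
Context {K : fieldType} {n m : nat} (d : 'I_m -> int) (U : set (freemod K n 'I_m)).
Hypothesis hU : quasi_stable U.

Local Notation fr := (pommaret_frame U).

Lemma Mf_functor : is_functor (Mf d U).
Proof.
split=> [A B s _ _ M /(Mf_marked_basis hU)[F mbF]|A _ M [subM _ _]|A B C s t _ _ _ M _].
- exact: marked_basis_Mf (marked_basis_map hU s mbF).
- exact: base_change_id.
- exact: base_change_comp.
Qed.

Lemma Mfsyz_functor : is_functor (Mfsyz d U).
Proof.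
have [Mf_act Mf_id _] := Mf_functor.
split=> [A B s nA nB|A nA|A B C s t _ _ _] [M S] /=.
- move=> [MfM [F [mbF /= ->]]]; split; first exact: (Mf_act A B s nA nB M MfM).
  exists (map_freemod s \o F); split; first exact: marked_basis_map.
  exact: (base_change_syzygies s (pommaret_heads_frame hU 0) (marked_basis_frame hU mbF)).
- move=> [/= MfM [F [_ /= ->]]]; congr (_, _); first exact: (Mf_id A nA M MfM).
  by apply: base_change_id; exact: syzygies_submodule.
- by move=> _; congr (_, _); exact: base_change_comp.
Qed.

Lemma Mfres_functor : is_functor (Mfres d U).
Proof.
have [Mf_act Mf_id _] := Mf_functor.
split=> [A B s nA nB|A nA|A B C s t _ _ _] [M S] /=.
- move=> [MfM [F [mbF resF /= eqS]]]; split; first exact: (Mf_act A B s nA nB M MfM).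
  exists (fun t => map_freemod s \o F t); split; first exact: marked_basis_map.
    exact: resolution_map resF.
  move=> t /=; rewrite eqS.
  apply: (base_change_syzygies s (pommaret_heads_frame hU t)).
  exact: (resolution_basis (pommaret_heads_frame hU 0) t (marked_basis_frame hU mbF) resF).
- move=> [/= MfM [F [_ _ /= eqS]]]; congr (_, _); first exact: (Mf_id A nA M MfM).
  apply: functional_extensionality_dep => t; rewrite eqS; apply: base_change_id.
  exact: syzygies_submodule.
- move=> _; congr (_, _); first exact: base_change_comp.
  by apply: functional_extensionality_dep => r; exact: base_change_comp.
Qed.

End Functoriality.

Theorem proposition4p6 (K : fieldType) (n m : nat) (d : 'I_m -> int)
    (U : set (freemod K n 'I_m)) (hU : quasi_stable U) :
  natural_isomorphism (X := Mfsyz d U) (Y := Mf d U) (fun A MS => MS.1) /\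
  natural_isomorphism (X := Mfres d U) (Y := Mf d U) (fun A MS => MS.1).
Proof.
have hL := pommaret_heads_frame hU 0.
split; split; try exact: Mf_functor.
- exact: Mfsyz_functor.
- by [].
- move=> A _; split=> [[M S] [] //|[M S] [M' S'] /set_mem[/= MfM [F [mbF /= ->]]]|M MfM].
    move=> /set_mem[/= _ [F' [mbF' /= ->]]] /= eqM; rewrite -eqM in mbF' *.
    by have [subM _ _] := MfM; rewrite (marked_basis_unique subM mbF mbF').
  have [F mbF] := Mf_marked_basis hU MfM.
  by exists (M, syzygies F) => //; split=> //; exists F.
- exact: Mfres_functor.
- by [].
- move=> A _; split=> [[M S] [] //|[M S] [M' S'] /set_mem[/= MfM [F [mbF resF /= eqS]]]|M MfM].
    move=> /set_mem[/= _ [F' [mbF' resF' /= eqS']]] /= eqM; rewrite -eqM in mbF' *.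
    congr (_, _); apply: functional_extensionality_dep => t; rewrite eqS eqS'.
    have [subM _ _] := MfM; have eq0 := marked_basis_unique subM mbF mbF'.
    by rewrite (resolution_unique hL t (marked_basis_frame hU mbF) eq0 resF resF').
  have [F0 mbF] := Mf_marked_basis hU MfM.
  have [F [eqF0 resF]] := resolution_exists hL (marked_basis_frame hU mbF).
  exists (M, fun t : 'I_(n - min_index U) => syzygies (F t)) => //; split=> //.
  by exists F; split=> //; rewrite eqF0.
Qed.
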